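(* Let $S$ be a manifold-like combinatorial cell complex (c.c.c.) of dimension $n$, with orientable and acyclic cells. Then $H_{\bullet}(S)\simeq H_{\bullet}(S^{(1)})$, where $S^{(1)}$ is the first barycentric subdivision of $S$.
   Context: C.c.c. A combinatorial cell complex (c.c.c.) is a finite poset $(S,\le)$ with a rank function $\mathrm{rk}\colon S\to\mathbb{Z}_{\ge 0}$; elements are called cells, $S(r)$ is the set of cells of rank $r$ ($0$-cells are vertices). A face of $x$ is a cell $y<x$ with $\mathrm{rk}(y)=\mathrm{rk}(x)-1$; then $x$ is a co-face of $y$. $\Delta x$ (resp. $\nabla x$) is the set of faces (resp. co-faces) of $x$. $\wedge$, $\vee$ denote greatest lower bound and least upper bound (considered for nonempty subsets only). Axioms: (1) $y<x$ implies $\mathrm{rk}(y)<\mathrm{rk}(x)$. (2) Every nonempty subset $T\subseteq S$ that is bounded below has a greatest lower bound $\wedge T$; and if $y<x$ there is a cell $y'$ with $\mathrm{rk}(y')=\mathrm{rk}(y)+1$ and $y<y'\le x$. (3) Each cell $x$ of rank at least one is the least upper bound of its faces, $x=\vee\Delta x$ (in particular $\Delta x\ne\emptyset$). (4) If $y<x$ and $\mathrm{rk}(x)=\mathrm{rk}(y)+2$ then $\Delta x\cap\nabla y$ consists of exactly two cells $y_+\neq y_-$, and $y_+\wedge y_-=y$. Write $\mathrm{cl}(x)=\{y\in S: y\le x\}$; down-closed subsets of $S$, with induced order and rank, are c.c.c.'s. Manifold-like. The dimension of $S$ is the maximal rank of a cell. $S$ is equidimensional of dimension $n$ if every maximal cell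 has rank $n$. For such $S$, the boundary is the set of cells of rank $<n$ having only one maximal cell above them. $S$ is non-singular if it is equidimensional (of dimension $n$), each $(n-1)$-cell is a face of at most two maximal cells, and each $1$-cell has exactly two vertices. $S$ is manifold-like if it is non-singular with empty boundary. Barycentric subdivision. $S^{(1)}$ is the set of all nonempty totally ordered subsets of $S$, ordered by inclusion, a chain $\{x_0<\dots<x_r\}$ having rank $r$. It is a c.c.c. (a simplicial complex), all of whose cells are orientable. Orientation. A flag in an equidimensional c.c.c. $S$ of dimension $n$ is a chain $x_0<x_1<\dots<x_n$ with $x_i\in S(i)$; $\mathcal{F}(S)$ is the set of flags. Two flags are adjacent if they differ in exactly one element; this makes $\mathcal{F}(S)$ a graph. $S$ is orientable if this graph is connected and bipartite. An orientation is a function $\omega\colon\mathcal{F}(S)\to\{\pm1\}$ taking opposite values on adjacent flags. A cell $x$ is orientable if $\mathrm{cl}(x)$ is; an orientation on $x$ means one on $\mathrm{cl}(x)$; $\mathcal F(x)=\mathcal F(\mathrm{cl}(x))$. Homology. Let $S$ be a c.c.c. all of whose cells are orientable. Choose an orientation $\omega_x$ on each cell $x$ (with $\omega_v(\{v\})=1$ for vertices $v$). For $y\in\Delta x$ put $s(x,y)=\omega_x(\gamma)/\omega_y(\gamma\setminus\{x\})\in\{\pm1\}$ for any flag $\gamma=\{x>y>\cdots\}\in\mathcal{F}(x)$ (independent of $\gamma$). $C_i(S)$ is the free abelian group on symbols $[x]$, $x\in S(i)$, and $\partial[x]=\sum_{y\in\Delta x}s(x,y)[y]$. $H_i(S)$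 is the homology of $(C_\bullet(S),\partial)$ in degree $i$; up to isomorphism it does not depend on the chosen orientations. $S$ is acyclic if $H_i(S)=0$ for $i>0$ and $H_0(S)\simeq\mathbb{Z}$; a cell $x$ is acyclic if $\mathrm{cl}(x)$ is. *)

(* Defs.v *)
From HB Require Import structures.
From mathcomp Require Import all_boot all_order all_algebra.
From mathcomp Require Import boolp.

Set Implicit Arguments.
Unset Strict Implicit.
Unset Printing Implicit Defensive.

Import Order.TTheory GRing.Theory.
Local Open Scope ring_scope.
Local Open Scope order_scope.

Section Bounds.
Context {d : Order.disp_t} {T : porderType d}.

Definition lower_bound (A : {pred T}) (m : T) := forall a, a \in A -> m <= a.
Definition upper_bound (A : {pred T}) (m : T) := forall a, a \in A -> a <= m.

Definition is_glb (A : {pred T}) (m : T) :=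
  lower_bound A m /\ forall b, lower_bound A b -> b <= m.
Definition is_lub (A : {pred T}) (m : T) :=
  upper_bound A m /\ forall b, upper_bound A b -> m <= b.

End Bounds.

Definition faces_of d (T : finPOrderType d) (rk : T -> nat) (x : T) : {set T} :=
  [set y | (y < x) && (rk x == (rk y).+1)].
Definition cofaces_of d (T : finPOrderType d) (rk : T -> nat) (y : T) : {set T} :=
  [set x | y \in faces_of rk x].

HB.mixin Record isCCC (d : Order.disp_t) T of Order.FinPOrder d T := {
  rk : T -> nat;
  rk_lt : forall x y : T, y < x -> (rk y < rk x)%N;
  glb_exists : forall A : {set T}, A != set0 ->
    (exists b : T, lower_bound A b) -> exists m : T, is_glb A m;
  rk_step : forall x y : T, y < x ->
    exists y' : T, rk y' = (rk y).+1 /\ y < y' <= x;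
  faces_lub : forall x : T, (1 <= rk x)%N ->
    faces_of rk x != set0 /\ is_lub (faces_of rk x) x;
  rk_diamond : forall x y : T, y < x -> rk x = (rk y).+2 ->
    exists y1 y2 : T, [/\ y1 != y2,
      faces_of rk x :&: cofaces_of rk y = [set y1; y2] &
      is_glb [set y1; y2] y]
}.

#[short(type="cccType")]
HB.structure Definition CCC (d : Order.disp_t) :=
  { T of isCCC d T & Order.FinPOrder d T }.

Section CellComplexes.
Context {d : Order.disp_t} {S : cccType d}.
Implicit Types (x y : S) (D g : {set S}) (n : nat).

Definition faces x : {set S} := faces_of rk x.
Definition cl x : {set S} := [set y | y <= x].
Definition maximal_cell x : bool := [forall y : S, (x <= y) ==> (y == x)].

Definition equidimensional n := forall x, maximal_cell x -> rk x = n.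

Definition cccboundary n : {set S} :=
  [set x | (rk x < n)%N & #|[set m | maximal_cell m & x <= m]| == 1%N].

Definition nonsingular n :=
  [/\ equidimensional n,
      forall y, (rk y).+1 = n ->
        (#|[set m | maximal_cell m & y \in faces m]| <= 2)%N &
      forall e, rk e = 1%N -> #|[set v in cl e | rk v == 0%N]| = 2%N].

Definition manifold_like n := nonsingular n /\ cccboundary n = set0.

(* A down-closed set [D] of cells stands for the c.c.c. it forms with the
   induced order and rank. *)

Definition dimension D : nat := \max_(x in D) rk x.

Definition is_chain (A : {set S}) : bool :=
  [forall x in A, forall y in A, x >=< y].

(* A flag is represented by its set of elements. *)
Definition flags D : {set {set S}} :=
  [set g : {set S} | [&& g \subset D, is_chain g &
     [forall i : 'I_(dimension D).+1, #|[set x in g | rk x == i]| == 1%N]]].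

Definition adjacent g g' : bool :=
  (#|g :\: g'| == 1%N) && (#|g' :\: g| == 1%N).

Definition flag_graph D : rel {set S} :=
  [rel g g' | [&& g \in flags D, g' \in flags D & adjacent g g']].

Definition orientable D :=
  {in flags D &, forall g g', connect (flag_graph D) g g'} /\
  exists colour : {set S} -> bool,
    forall g g', flag_graph D g g' -> colour g != colour g'.

Definition orientation D (w : {set S} -> int) :=
  (forall g, g \in flags D -> w g = 1 \/ w g = - 1) /\
  (forall g g', flag_graph D g g' -> w g' = - w g).

End CellComplexes.

Arguments equidimensional {d} S n.
Arguments cccboundary {d} S n.
Arguments nonsingular {d} S n.
Arguments manifold_like {d} S n.

Lemma dim_cl d (S : cccType d) (x : S) : dimension (cl x) = rk x.
Proof.
apply/eqP; rewrite eqn_leq; apply/andP; split.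
  apply/bigmax_leqP => y; rewrite inE le_eqVlt => /predU1P[->//|/rk_lt/ltnW//].
by rewrite /dimension (bigD1 x) ?inE ?lexx /= ?leq_maxl.
Qed.

Record orientations d (S : cccType d) := Orientations {
  orient :> S -> {set S} -> int;
  orientP : forall x, orientation (cl x) (orient x);
  orient_vertex : forall v, rk v = 0%N -> orient v [set v] = 1
}.

Lemma orientations_exist d (S : cccType d) :
  (forall x : S, orientable (cl x)) -> inhabited (orientations S).
Proof.
move=> oS; have /choice[w wP] : forall x : S, exists w : {set S} -> int,
    orientation (cl x) w /\ w [set x] = 1%R.
  move=> x; have [_ [col colP]] := oS x.
  exists (fun g => ((-1) ^+ (col g (+) col [set x]))%R).
  split; last by rewrite addbb.
  split=> [g _|g g' /colP]; first by case: (_ (+) _); [right|left].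
  by case: (col g); case: (col g'); case: (col [set x]).
by constructor; exists w => [x|v _]; [case: (wP x) | case: (wP v)].
Qed.

Section Homology.
Local Open Scope ring_scope.
Context {d : Order.disp_t} {S : cccType d} (o : orientations S).
Implicit Types (x y : S) (D : {set S}) (i : nat).

(* The incidence number s(x, y), for y a face of x; the values of
   orientations being signs, their quotient is their product. *)
Definition incidence x y : int :=
  if [pick g in flags (cl x) | y \in g] is Some g
  then o x g * o y (g :\ x) else 0.

(* The chain group C_i(D) of a down-closed D is the free abelian group on the
   cells of D of rank i, that is, the group of functions supported there. *)
Notation chain := {ffun S -> int}.

Definition in_chains D i (c : chain) : bool :=
  [forall x, (c x != 0) ==> (x \in D) && (rk x == i)].

Definition cell_chain x : chain := [ffun y => (y == x)%:Z].

Definition bd_cell x : chain :=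
  \sum_(y in faces x) cell_chain y *~ incidence x y.
Definition bd (c : chain) : chain := \sum_(x : S) bd_cell x *~ c x.

Lemma in_chains_zmod D i : zmod_closed (in_chains D i).
Proof.
split=> [|b c /forallP bD /forallP cD]; apply/forallP=> x.
  by rewrite ffunE eqxx.
move: (bD x) (cD x); rewrite !ffunE.
by case: (_ && _); rewrite ?implybT // !implybF !negbK => /eqP-> /eqP->;
  rewrite subrr.
Qed.

Lemma bdB : {morph bd : b c / b - c}.
Proof.
move=> b c; rewrite /bd -sumrB; apply: eq_bigr => x _.
by rewrite !ffunE mulrzBr.
Qed.

Lemma bd0 : bd 0 = 0.
Proof. by have := bdB 0 0; rewrite !subrr. Qed.

Definition is_cycle D i : pred chain :=
  [pred c | in_chains D i c && (bd c == 0)].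

Lemma is_cycle_zmod D i : zmod_closed (is_cycle D i).
Proof.
have [C0 CB] := in_chains_zmod D i.
split=> [|b c]; rewrite !inE ?bd0 ?eqxx ?andbT //.
move=> /andP[bD /eqP b0] /andP[cD /eqP c0].
by rewrite bdB b0 c0 subrr eqxx andbT; apply: CB.
Qed.

HB.instance Definition _ D i :=
  GRing.isZmodClosed.Build chain (is_cycle D i) (is_cycle_zmod D i).

Record cycle D i := Cycle { cycle_val :> chain; _ : cycle_val \in is_cycle D i }.
HB.instance Definition _ D i := [isSub for @cycle_val D i].
HB.instance Definition _ D i := [Choice of cycle D i by <:].
HB.instance Definition _ D i := [SubChoice_isSubZmodule of cycle D i by <:].

Definition is_boundary D i : pred (cycle D i) :=
  fun z => `[< exists b : chain, in_chains D i.+1 b /\ bd b = z >].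

Lemma is_boundary_zmod D i : zmod_closed (@is_boundary D i).
Proof.
have [C0 CB] := in_chains_zmod D i.+1.
split=> [|y z /asboolP[b [bD by_]] /asboolP[c [cD cz]]]; apply/asboolP.
  by exists 0; rewrite bd0.
by exists (b - c); split; [exact: CB | rewrite bdB by_ cz].
Qed.

HB.instance Definition _ D i :=
  GRing.isZmodClosed.Build (cycle D i) (@is_boundary D i) (is_boundary_zmod D i).

Definition homology_of D i : zmodType :=
  Quotient.quot (GRing.ZmodClosed.clone (cycle D i) (@is_boundary D i) _).

End Homology.

Definition homology d (S : cccType d) (o : orientations S) (i : nat) : zmodType :=
  homology_of o [set: S] i.

Definition zmod_iso (A B : zmodType) :=
  exists f : {additive A -> B}, bijective f.

Definition acyclic d (S : cccType d) (o : orientations S) (D : {set S}) :=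
  (forall i, (0 < i)%N -> forall h : homology_of o D i, h = 0%R) /\
  zmod_iso (homology_of o D 0%N) int.

Section BarycentricSubdivision.
Context {d : Order.disp_t} (S : cccType d).

Record bary := Bary {
  bary_val :> {set S};
  _ : (bary_val != set0) && is_chain bary_val
}.
HB.instance Definition _ := [isSub for bary_val].
HB.instance Definition _ := [Finite of bary by <:].

Fact bary_display : Order.disp_t. Proof. exact: Order.Disp tt tt. Qed.

Definition bary_le (a b : bary) : bool := (a : {set S}) \subset b.

Fact bary_le_refl : reflexive bary_le.
Proof. by move=> a; apply: subxx. Qed.
Fact bary_le_anti : antisymmetric bary_le.
Proof. by move=> a b; rewrite /bary_le -eqEsubset => /eqP/val_inj. Qed.
Fact bary_le_trans : transitive bary_le.
Proof. by move=> b a c; apply: subset_trans. Qed.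

HB.instance Definition _ := Order.Le_isPOrder.Build bary_display bary
  bary_le_refl bary_le_anti bary_le_trans.

Definition bary_rk (a : bary) : nat := #|(a : {set S})|.-1.

Lemma baryP (a : bary) : (0 < #|(a : {set S})|)%N /\ is_chain a.
Proof. by case: a => a /= /andP[a0 ca]; rewrite card_gt0. Qed.

Lemma is_chain_sub (A B : {set S}) : A \subset B -> is_chain B -> is_chain A.
Proof.
move=> AB /forall_inP cB; apply/forall_inP => x xA; apply/forall_inP => y yA.
by move/forall_inP: (cB x (subsetP AB x xA)); apply; exact: subsetP AB y yA.
Qed.

Lemma bary_sub (a : bary) (A : {set S}) : A != set0 -> A \subset a ->
  {b : bary | b = A :> {set S}}.
Proof.
move=> A0 Aa; have [_ ca] := baryP a.
have pA : (A != set0) && is_chain A by rewrite A0 (is_chain_sub Aa ca).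
by exists (Bary pA).
Qed.

Lemma bary_leE (a b : bary) : (a <= b) = ((a : {set S}) \subset b).
Proof. by []. Qed.

Lemma bary_ltE (a b : bary) : (a < b) = ((a : {set S}) \proper b).
Proof.
by rewrite lt_neqAle bary_leE properEneq -(inj_eq val_inj).
Qed.

Lemma bary_rk_lt (a b : bary) : b < a -> (bary_rk b < bary_rk a)%N.
Proof.
rewrite bary_ltE => /proper_card; rewrite /bary_rk.
have [+ _] := baryP a; have [+ _] := baryP b.
by case: #|_| => // m; case: #|_|.
Qed.

Lemma bary_facesE (a b : bary) : (b \in faces_of bary_rk a) =
  ((b : {set S}) \subset a) && (#|(a : {set S})| == #|(b : {set S})|.+1).
Proof.
rewrite inE bary_ltE /bary_rk.
have [+ _] := baryP b; have [+ _] := baryP a.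
case ea: #|(a : {set S})| => [|k] // _; case eb: #|(b : {set S})| => [|m] // _.
rewrite /= [in RHS]eqSS.
case: (k =P m.+1) => [kl|]; last by rewrite !andbF.
by rewrite !andbT properEcard ea eb kl ltnS leqnn andbT.
Qed.

Lemma bary_faceD1 (a : bary) (x : S) : (1 < #|(a : {set S})|)%N -> x \in bary_val a ->
  {b : bary | b = (a : {set S}) :\ x :> {set S} & b \in faces_of bary_rk a}.
Proof.
move=> a1 xa.
have ca := cardsD1 x a; rewrite xa in ca.
have [|b bE] := @bary_sub a (a :\ x) _ (subsetDl _ _).
  by rewrite -card_gt0; move: a1; rewrite ca.
by exists b => //; rewrite bary_facesE bE subsetDl ca /=.
Qed.

Lemma bary_glb (A : {set bary}) : A != set0 ->
  (exists b : bary, lower_bound A b) -> exists m : bary, is_glb A m.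
Proof.
move=> /set0Pn[a aA] [b bA].
pose I := \bigcap_(c in A) (c : {set S}).
have bI : (b : {set S}) \subset I by apply/bigcapsP => c /bA.
have [||m mE] := @bary_sub a I.
- rewrite -card_gt0 (leq_trans _ (subset_leq_card bI)) //.
  by have [] := baryP b.
- exact: bigcap_inf.
exists m; split=> [c cA|c cA]; rewrite bary_leE mE; first exact: bigcap_inf.
by apply/bigcapsP => e /cA.
Qed.

Lemma bary_step (a b : bary) : b < a ->
  exists c : bary, bary_rk c = (bary_rk b).+1 /\ b < c <= a.
Proof.
rewrite bary_ltE => /properP[ba [x xa xb]].
have [||c cE] := @bary_sub a (x |: b).
- by apply/set0Pn; exists x; rewrite setU11.
- by rewrite subUset sub1set xa.
exists c; have [b0 _] := baryP b.
rewrite bary_ltE bary_leE /bary_rk cE cardsU1 xb add1n /= prednK //; split=> //.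
rewrite subUset sub1set xa ba /= andbT properE subsetU1 /=.
by apply/subsetPn; exists x; rewrite ?setU11.
Qed.

Lemma bary_faces_lub (a : bary) : (1 <= bary_rk a)%N ->
  faces_of bary_rk a != set0 /\ is_lub (faces_of bary_rk a) a.
Proof.
move=> ra; have a1 : (1 < #|(a : {set S})|)%N.
  by move: ra; rewrite /bary_rk; case: #|_|.
split; [|split].
- have [x xa] : exists x, x \in bary_val a.
    by apply/set0Pn; rewrite -card_gt0 ltnW.
  by have [b _ ba] := bary_faceD1 a1 xa; apply/set0Pn; exists b.
- by move=> b; rewrite bary_facesE => /andP[].
move=> b ub; rewrite bary_leE; apply/subsetP => x xa.
have [y ya yx] : exists2 y, y \in bary_val a & y != x.
  have : (0 < #|(a : {set S}) :\ x|)%N.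
    by move: a1; rewrite (cardsD1 x a) xa.
  by rewrite card_gt0 => /set0Pn[y]; rewrite !inE => /andP[]; exists y.
have [c cE /ub] := bary_faceD1 a1 ya.
by rewrite bary_leE cE => /subsetP; apply; rewrite !inE xa eq_sym yx.
Qed.

Lemma bary_diamond (a b : bary) : b < a -> bary_rk a = (bary_rk b).+2 ->
  exists c1 c2 : bary, [/\ c1 != c2,
    faces_of bary_rk a :&: cofaces_of bary_rk b = [set c1; c2] &
    is_glb [set c1; c2] b].
Proof.
rewrite bary_ltE => /proper_sub ba rab.
have [b0 _] := baryP b; have [a0 _] := baryP a.
have cab : #|(a : {set S})| = #|(b : {set S})|.+2.
  move: rab a0 b0; rewrite /bary_rk.
  by case: #|_| => // k; case: #|_| => //= l ->.
have /eqP : #|bary_val a :\: b| = 2%N by rewrite cardsDS // cab -addn2 addKn.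
case/cards2P=> x [y [xy abE]].
have /andP[xa xb] : (x \in bary_val a) && (x \notin bary_val b).
  by rewrite andbC -in_setD abE set21.
have /andP[ya yb] : (y \in bary_val a) && (y \notin bary_val b).
  by rewrite andbC -in_setD abE set22.
have sub z : z \in bary_val a -> z |: b \subset a.
  by move=> za; rewrite subUset sub1set za.
have ne z : z |: (b : {set S}) != set0.
  by apply/set0Pn; exists z; rewrite setU11.
have [c1 c1E] := bary_sub (ne x) (sub x xa).
have [c2 c2E] := bary_sub (ne y) (sub y ya).
exists c1, c2; split.
- apply/eqP => c12; have : x \in bary_val c2 by rewrite -c12 c1E setU11.
  by rewrite c2E !inE (negPf xy) (negPf xb).
- apply/setP => c; rewrite in_setI bary_facesE inE bary_facesE cab eqSS.
  apply/idP/idP.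
    move=> /andP[/andP[ca _] /andP[bc cb]].
    have [z zc zb] : exists2 z, z \in bary_val c & z \notin bary_val b.
      by apply/subsetPn/negP => /subset_leq_card; rewrite (eqP cb) ltnn.
    have zE : bary_val c = z |: b.
      apply/eqP; rewrite eq_sym eqEcard subUset sub1set zc bc /=.
      by rewrite cardsU1 zb (eqP cb).
    have : z \in bary_val a :\: b by rewrite inE zb (subsetP ca).
    rewrite abE => /set2P[] zxy; rewrite zxy in zE; apply/set2P.
      by left; apply: val_inj; rewrite /= zE c1E.
    by right; apply: val_inj; rewrite /= zE c2E.
  by move=> /set2P[]->; rewrite ?c1E ?c2E subsetU1 sub // cardsU1 ?xb ?yb !eqxx.
split=> [c /set2P[]->|c lc]; rewrite bary_leE ?c1E ?c2E ?subsetU1 //.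
have := lc c1 (set21 _ _); have := lc c2 (set22 _ _).
rewrite !bary_leE c1E c2E => /subsetP cy /subsetP cx.
apply/subsetP => z zc; move: (cx z zc) (cy z zc); rewrite !inE.
by case/orP=> // /eqP->; rewrite (negPf xy).
Qed.

HB.instance Definition _ := isCCC.Build bary_display bary
  bary_rk_lt bary_glb bary_step bary_faces_lub bary_diamond.

End BarycentricSubdivision.

(* The cells of the barycentric subdivision carry orientations: compare the order
   in which a flag adds the vertices of a simplex with their order in [S]. *)

Section BaryOrientation.
Context {d : Order.disp_t} (S : cccType d).
Implicit Types (a b c : bary S) (g : {set bary S}).

Definition before g (x y : S) : bool :=
  [exists b in g, (x \in bary_val b) && (y \notin bary_val b)].

Definition inversions a g : {set S * S} :=
  [set p | [&& p.1 \in bary_val a, p.2 \in bary_val a, p.1 < p.2 &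
              before g p.2 p.1]].

Lemma bary_cardE a : #|bary_val a| = (rk a).+1.
Proof. by have [a0 _] := baryP a; rewrite /rk /= /bary_rk prednK. Qed.

Lemma flag_baryP a g : g \in flags (cl a) ->
  [/\ forall b, b \in g -> bary_val b \subset a,
      {in g &, forall b c, (rk b <= rk c)%N -> bary_val b \subset c} &
      forall i, (i <= rk a)%N -> exists2 b, b \in g & rk b = i].
Proof.
rewrite inE dim_cl => /and3P[/subsetP ga /forall_inP cg /forallP g1].
split=> [b /ga|b c bg cg' bc|i ia].
- by rewrite inE.
- have /forall_inP/(_ c cg') := cg b bg.
  case/orP=> //; rewrite le_eqVlt => /predU1P[->//|/rk_lt].
  by rewrite ltnNge bc.
have /cards1P[b /setP/(_ b)] := g1 (Ordinal (ia : (i < (rk a).+1)%N)).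
rewrite !inE eqxx => /andP[bg /eqP]; by exists b.
Qed.

Lemma flag_bary_inj a g b c : g \in flags (cl a) -> b \in g -> c \in g ->
  rk b = rk c -> b = c.
Proof.
move=> /flag_baryP[_ gs _] bg cg bc; apply/val_inj/eqP; rewrite /= eqEsubset.
by rewrite !gs // bc.
Qed.

Lemma flag_adj a g g' : flag_graph (cl a) g g' ->
  exists u v : S, [/\ u \in bary_val a, v \in bary_val a,
    [/\ before g u v, ~~ before g' u v, before g' v u & ~~ before g v u] &
    forall x y, (x, y) != (u, v) -> (x, y) != (v, u) ->
      before g x y = before g' x y].
Proof.
move=> /and3P[gF g'F /andP[/cards1P[c cE] /cards1P[c' c'E]]].
have [ga gs gr] := flag_baryP gF; have [g'a g's g'r] := flag_baryP g'F.
have /andP[cg cg'] : (c \in g) && (c \notin g').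
  by have := set11 c; rewrite -cE inE andbC.
have /andP[c'g' c'g] : (c' \in g') && (c' \notin g).
  by have := set11 c'; rewrite -c'E inE andbC.
have gh b : b \in g -> b != c -> b \in g'.
  by move=> bg; apply: contraR => bg'; rewrite -in_set1 -cE inE bg bg'.
have g'h b : b \in g' -> b != c' -> b \in g.
  by move=> bg; apply: contraR => bg'; rewrite -in_set1 -c'E inE bg bg'.
have ca := ga c cg; have c'a := g'a c' c'g'.
have rca : (rk c <= rk a)%N by rewrite -ltnS -!bary_cardE subset_leq_card.
have rc : rk c' = rk c.
  have [b bg' rb] := g'r _ rca.
  have [<-//|bc'] := eqVneq b c'.
  have bg := g'h b bg' bc'.
  by have bc := flag_bary_inj gF bg cg rb; rewrite -bc bg' in cg'.
have cc' : c != c' by apply: contraNneq cg' => ->.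
have rltca : (rk c < rk a)%N.
  rewrite ltn_neqAle rca andbT; apply: contra cc' => /eqP rE.
  have -> : c = a.
    by apply/val_inj/eqP; rewrite eqEcard ca !bary_cardE rE /=.
  by apply/eqP/val_inj/eqP; rewrite eq_sym eqEcard c'a !bary_cardE rc rE /=.
have hup b : b \in g -> (rk c < rk b)%N ->
    (bary_val c \subset b) && (bary_val c' \subset b).
  move=> bg bc; have bg' : b \in g' by apply: gh => //; apply: contraTneq bc => ->; rewrite ltnn.
  by rewrite gs ?g's // ?rc ltnW.
have hdn b : b \in g -> (rk b < rk c)%N ->
    (bary_val b \subset c) && (bary_val b \subset c').
  move=> bg bc; have bg' : b \in g' by apply: gh => //; apply: contraTneq bc => ->; rewrite ltnn.
  by rewrite gs ?g's // ?rc ltnW.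
have card_cc' : #|bary_val c :&: c'| = rk c.
  apply/eqP; rewrite eqn_leq; apply/andP; split.
    rewrite -ltnS -bary_cardE proper_card // properEneq subsetIl andbT.
    apply: contra cc' => /eqP/setIidPl sub; apply/eqP/val_inj/eqP.
    by rewrite eqEcard sub !bary_cardE rc /=.
  case E : (rk c) => [//|k].
  have [|b bg rb] := gr k; first by move: rltca; rewrite E => /ltnW/ltnW.
  have /andP[bc bc'] : (bary_val b \subset c) && (bary_val b \subset c').
    by apply: hdn => //; rewrite rb E.
  by rewrite -rb -bary_cardE subset_leq_card // subsetI bc.
have [u uE] : exists u, bary_val c :\: c' = [set u].
  by apply/cards1P; rewrite cardsD card_cc' bary_cardE subSnn.
have [v vE] : exists v, bary_val c' :\: c = [set v].
  by apply/cards1P; rewrite cardsD setIC card_cc' bary_cardE rc subSnn.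
have /andP[uc uc'] : (u \in bary_val c) && (u \notin bary_val c').
  by have := set11 u; rewrite -uE inE andbC.
have /andP[vc' vc] : (v \in bary_val c') && (v \notin bary_val c).
  by have := set11 v; rewrite -vE inE andbC.
have uP x : x \in bary_val c -> x \notin bary_val c' -> x = u.
  by move=> xc xc'; apply/set1P; rewrite -uE inE xc xc'.
have vP x : x \in bary_val c' -> x \notin bary_val c -> x = v.
  by move=> xc xc'; apply/set1P; rewrite -vE inE xc xc'.
have hcase b : b \in g -> b != c ->
    (u \in bary_val b) && (v \in bary_val b) ||
    (u \notin bary_val b) && (v \notin bary_val b).
  move=> bg bc; case: (ltngtP (rk b) (rk c)) => rbc.
  - have /andP[/subsetP s1 /subsetP s2] := hdn b bg rbc.
    by rewrite (contra (s2 u) uc') (contra (s1 v) vc) orbT.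
  - have /andP[/subsetP s1 /subsetP s2] := hup b bg rbc.
    by rewrite (s1 u) // (s2 v).
  - by rewrite (flag_bary_inj gF bg cg rbc) eqxx in bc.
have [bu bug rbu] : exists2 b, b \in g & rk b = (rk c).+1 by apply: gr.
have buE : bary_val bu = v |: c.
  apply/eqP; rewrite eq_sym eqEcard subUset sub1set cardsU1 vc !bary_cardE rbu.
  have /andP[s1 /subsetP s2] : (bary_val c \subset bu) && (bary_val c' \subset bu).
    by apply: hup; rewrite ?rbu.
  by rewrite s1 s2 // leqnn.
have buE' : bary_val bu = u |: c'.
  apply/eqP; rewrite eq_sym eqEcard subUset sub1set cardsU1 uc' !bary_cardE rbu.
  have /andP[/subsetP s1 s2] : (bary_val c \subset bu) && (bary_val c' \subset bu).
    by apply: hup; rewrite ?rbu.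
  by rewrite s2 s1 // rc leqnn.
have bug' : bu \in g'.
  apply: gh => //; apply/eqP => E; move: rbu; rewrite E => /eqP.
  by rewrite eqn_leq ltnn andbF.
have hbd y : y \in bary_val c -> y \in bary_val c' ->
    exists2 b, (b \in g) && (b \in g') &
      [/\ y \in bary_val b, u \notin bary_val b & v \notin bary_val b].
  move=> yc yc'; have : (0 < rk c)%N.
    by rewrite -card_cc' card_gt0; apply/set0Pn; exists y; rewrite inE yc.
  case E : (rk c) => [//|k] _.
  have [|b bg rb] := gr k; first by move: rltca; rewrite E => /ltnW/ltnW.
  have rbc : (rk b < rk c)%N by rewrite rb E.
  have /andP[s1 s2] := hdn b bg rbc.
  have bE : bary_val b = bary_val c :&: c'.
    by apply/eqP; rewrite eqEcard subsetI s1 s2 card_cc' bary_cardE rb E /=.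
  exists b.
    by rewrite bg gh //; apply: contraTneq rbc => ->; rewrite ltnn.
  by rewrite bE !inE yc yc' (negPf uc') (negPf vc) andbF.
exists u, v; split.
- exact: (subsetP ca).
- exact: (subsetP c'a).
- split.
  + by apply/exists_inP; exists c; rewrite // uc.
  + apply/negP => /exists_inP[b bg' /andP[ub vb]].
    have [bc'|bc'] := eqVneq b c'; first by rewrite bc' (negPf uc') in ub.
    have bg := g'h b bg' bc'.
    have [bc|bc] := eqVneq b c; first by rewrite -bc bg' in cg'.
    by have := hcase b bg bc; rewrite ub (negPf vb).
  + by apply/exists_inP; exists c'; rewrite // vc'.
  + apply/negP => /exists_inP[b bg /andP[vb ub]].
    have [bc|bc] := eqVneq b c; first by rewrite bc (negPf vc) in vb.
    by have := hcase b bg bc; rewrite vb (negPf ub).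
move=> x y xy yx; apply/exists_inP/exists_inP => -[b bg /andP[xb yb]].
- have [bc|bc] := eqVneq b c; last by exists b; rewrite ?gh // xb.
  rewrite {}bc in xb yb.
  have [xc'|xc'] := boolP (x \in bary_val c').
    have [yc'|yc'] := boolP (y \in bary_val c').
      have [e /andP[eg eg'] [xe ue ve]] := hbd x xb xc'.
      by exists e; rewrite // xe (vP y).
    by exists c'; rewrite // xc'.
  exists bu => //; rewrite buE !inE xb orbT (negPf yb) orbF /=.
  by apply: contra xy => /eqP->; rewrite (uP x).
- have [bc|bc] := eqVneq b c'; last by exists b; rewrite ?g'h // xb.
  rewrite {}bc in xb yb.
  have [xc|xc] := boolP (x \in bary_val c).
    have [yc|yc] := boolP (y \in bary_val c).
      have [e /andP[eg eg'] [xe ue ve]] := hbd x xc xb.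
      by exists e; rewrite // xe (uP y).
    by exists c; rewrite // xc.
  exists bu => //; rewrite buE' !inE xb orbT (negPf yb) orbF /=.
  by apply: contra yx => /eqP->; rewrite (vP x).
Qed.


Lemma inversions_adj a g g' : flag_graph (cl a) g g' ->
  odd #|inversions a g'| = ~~ odd #|inversions a g|.
Proof.
move=> gg'; have [u [v [ua va]]] := flag_adj gg'; rewrite {gg'}.
wlog uv : g g' u v ua va / u < v => [hw|].
  move=> [b1 b2 b3 b4] e.
  have uv : u != v by apply: contraNneq b2 => uv; rewrite {2}uv -uv in b3 *.
  have [_ /forall_inP/(_ u ua)/forall_inP/(_ v va)/orP[]] := baryP a;
    rewrite le_eqVlt ?(negPf uv) 1?eq_sym ?(negPf uv) /= => lt_uv.
    exact: hw e.
  apply: negb_inj; rewrite negbK; apply/esym.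
  by apply: (hw g' g v u) => // x y xy yx; rewrite e.
move=> [b1 b2 b3 b4] e.
have -> : inversions a g' = (u, v) |: inversions a g.
  apply/setP => -[x y]; rewrite !inE /=.
  have [/eqP[-> ->]|xy] := boolP ((x, y) == (u, v)); first by rewrite ua va uv b3.
  have [/eqP[-> ->]|yx] := boolP ((x, y) == (v, u)).
    by rewrite (lt_gtF uv) !andbF.
  rewrite (e y x) //; first by apply: contra yx => /eqP[-> ->].
  by apply: contra xy => /eqP[-> ->].
by rewrite cardsU1 inE /= (negPf b4) !andbF.
Qed.

Lemma bary_orientation a :
  orientation (cl a) (fun g => ((-1) ^+ #|inversions a g|)%R).
Proof.
split=> [g _|g g' /inversions_adj e]; rewrite -!(signr_odd _ #|_|).
  by case: odd; [right; rewrite expr1|left; rewrite expr0].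
by rewrite e; case: odd; rewrite /= ?expr1 ?expr0 ?opprK.
Qed.

Lemma bary_orient_vertex a : rk a = 0%N ->
  ((-1) ^+ #|inversions a [set a]|)%R = 1%R :> int.
Proof.
move=> a0; have /eqP/cards1P[x ax] : #|bary_val a| = 1%N by rewrite bary_cardE a0.
suff -> : inversions a [set a] = set0 by rewrite cards0 expr0.
apply/setP => -[y z]; rewrite !inE /= ax !inE.
by case: eqP => //= ->; case: eqP => //= ->; rewrite ltxx.
Qed.

Definition bary_orientations : orientations (bary S) :=
  Orientations bary_orientation bary_orient_vertex.

End BaryOrientation.

(* Main.v *)
Require Import Defs.
From mathcomp Require Import all_boot all_order.
From HB Require Import structures.
From mathcomp Require Import generic_quotient all_algebra.
From mathcomp Require Import boolp.

(** The theorem is an instance of the method of acyclic carriers.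

    A chain map between augmented cellular chain complexes is carried by a
    function [Phi] from cells to subcomplexes if the image of each cell [x] is a
    chain of [Phi x]. When [Phi] is monotone and its values have vanishing reduced
    homology, induction on the rank of cells, filling one cycle of [Phi x] at
    each step, shows that a carried map exists ([carried_map_exists]) and that it
    is unique up to homotopy ([carried_maps_homotopic]).

    There are two natural carriers. A cell [x] of [S] is sent to the subdivision
    of its closure, that is, to the chains of cells below [x]. This is a cone with
    apex [x], hence acyclic ([bary_cl_aug_acyclic]). A simplex of the subdivision,
    that is, a chain of cells, is sent to the closure of its largest cell,
    which is acyclic by hypothesis (and then also for reduced homology, by
    [acyclic_aug_acyclic]). Both composites of the resulting chain maps
    are carried, like the identity, by an acyclic carrier: the closure of [x]
    on one side, the subdivided closure of the largest cell on the other. So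
    the two maps are inverse to each other up to homotopy ([bary_homology_iso]).

    This needs both cellular complexes to be augmented complexes. If any two
    flags of a cell are connected by adjacent ones, the incidence number of a
    cell and a face can be computed on every flag ([incidenceE]), and exchanging
    two faces changes the sign ([incidence_swap]); this gives that the square
    of the boundary vanishes and that an edge with two ends has a boundary of
    augmentation zero. In [S], the connectedness comes from the orientability
    of the cells and the ends of edges from non-singularity; in the
    subdivision, where cells are simplices, both are proved
    directly ([bary_flags_connected], [bary_edge_faces]). *)

Set Implicit Arguments.
Unset Strict Implicit.
Unset Printing Implicit Defensive.

Import Order.TTheory GRing.Theory.
Local Open Scope order_scope.

(** * Flags of a cell *)

Section Flags.
Context {d : Order.disp_t} {S : cccType d}.
Implicit Types (x y z : S) (g h : {set S}).

Lemma faceP x y : reflect (y < x /\ rk x = (rk y).+1) (y \in faces x).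
Proof. by rewrite inE; apply: (iffP andP) => -[yx rx]; split=> //; apply/eqP. Qed.

Lemma eq_of_rk x z : z <= x -> rk z = rk x -> z = x.
Proof. by rewrite le_eqVlt => /predU1P[//|/rk_lt zx rE]; rewrite rE ltnn in zx. Qed.

Lemma flagsP x g : reflect
  [/\ {in g, forall z, z <= x}, {in g &, forall z z', z >=< z'} &
      forall i, (i <= rk x)%N -> #|[set z in g | rk z == i]| = 1%N]
  (g \in flags (cl x)).
Proof.
rewrite inE dim_cl; apply: (iffP and3P).
  case=> /subsetP gx /forall_inP cg /forallP g1; split.
  - by move=> z /gx; rewrite inE.
  - by move=> z z' zg z'g; have /forall_inP/(_ _ z'g) := cg z zg.
  by move=> i ix; apply/eqP; have := g1 (Ordinal (ix : (i < (rk x).+1)%N)).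
case=> gx cg g1; split.
- by apply/subsetP => z /gx; rewrite inE.
- by apply/forall_inP => z zg; apply/forall_inP => z'; apply: cg.
by apply/forallP => i; apply/eqP/g1; rewrite -ltnS.
Qed.

Lemma flag_top x g : g \in flags (cl x) -> x \in g.
Proof.
case/flagsP=> gx _ /(_ (rk x) (leqnn _))/eqP/cards1P[z].
move/setP/(_ z); rewrite !inE eqxx => /andP[zg /eqP zx].
by rewrite -(eq_of_rk (gx z zg) zx).
Qed.

Lemma flag_le_rk x g z : g \in flags (cl x) -> z \in g -> (rk z <= rk x)%N.
Proof.
by case/flagsP=> gx _ _ /gx; rewrite le_eqVlt => /predU1P[->//|/rk_lt/ltnW].
Qed.

Lemma face_notin_flag x y h : y \in faces x -> h \in flags (cl y) -> x \notin h.
Proof.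
move=> /faceP[_ rx] hF; apply/negP => /(flag_le_rk hF).
by rewrite rx ltnn.
Qed.

Lemma flag_cons x y h : y \in faces x -> h \in flags (cl y) ->
  x |: h \in flags (cl x).
Proof.
move=> yx hF; have hr := flag_le_rk hF; case/faceP: yx => yx rx.
case/flagsP: hF => hy ch h1.
have hx z : z \in x |: h -> z <= x.
  by case/setU1P=> [->//|/hy/le_trans]; apply; apply: ltW.
apply/flagsP; split=> // [z z'|i].
  move=> zh z'h; have [-> |zx] := eqVneq z x; first by rewrite /Order.comparable hx ?orbT.
  have [-> |z'x] := eqVneq z' x; first by rewrite /Order.comparable hx.
  by move: zh z'h; rewrite !in_setU1 (negPf zx) (negPf z'x); apply: ch.
rewrite leq_eqVlt => /predU1P[->|].
  apply/eqP/cards1P; exists x; apply/setP => z; rewrite !inE.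
  apply/andP/eqP => [[/predU1P[//|/hr]]|->]; last by rewrite !eqxx.
  by rewrite rx => /[swap] /eqP->; rewrite ltnn.
rewrite rx ltnS => iy; rewrite -(h1 i iy); apply: eq_card => z; rewrite !inE.
by have [->|//] := eqVneq z x; rewrite rx gtn_eqF ?ltnS ?andbF.
Qed.

Lemma flag_behead x y g : y \in faces x -> g \in flags (cl x) -> y \in g ->
  g :\ x \in flags (cl y).
Proof.
move=> /faceP[yx rx] /flagsP[gx cg g1] yg; apply/flagsP; split.
- move=> z /setD1P[zx zg]; have /orP[//|yz] := cg z y zg yg.
  have := gx z zg; rewrite le_eqVlt (negPf zx) => /rk_lt.
  rewrite rx ltnS le_eqVlt in yz * => zy.
  by case/predU1P: yz => [->//|/rk_lt]; rewrite ltnNge zy.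
- by move=> z z' /setD1P[_ zg] /setD1P[_ z'g]; apply: cg.
move=> i iy; rewrite -(g1 i); last by rewrite rx ltnW.
apply: eq_card => z; rewrite !inE.
by have [->|//] := eqVneq z x; rewrite rx gtn_eqF ?ltnS ?andbF.
Qed.

Lemma flag_rk0 x g : rk x = 0%N -> (g \in flags (cl x)) = (g == [set x]).
Proof.
move=> x0; apply/idP/eqP => [gF|->].
  apply/setP => z; rewrite inE; apply/idP/eqP => [zg|->]; last exact: flag_top.
  have := flag_le_rk gF zg; rewrite x0 leqn0 => /eqP z0.
  by case/flagsP: gF => gx _ _; apply: eq_of_rk; rewrite ?gx // z0.
apply/flagsP; split=> [z|z z'|i].
- by move/set1P->.
- by move=> /set1P-> /set1P->; apply: comparablexx.
rewrite x0 leqn0 => /eqP->; apply/eqP/cards1P; exists x.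
by apply/setP => z; rewrite !inE; case: eqP => // ->; rewrite x0 eqxx.
Qed.

Lemma has_face x : (0 < rk x)%N -> exists y, y \in faces x.
Proof. by move=> /faces_lub[/set0Pn]. Qed.

Lemma flag_exists x : exists h, h \in flags (cl x).
Proof.
elim: {x}(rk x) {-2}x (erefl (rk x)) => [|n IHn] x rx.
  by exists [set x]; rewrite flag_rk0.
have [|y yx] := @has_face x; first by rewrite rx.
have [|h hF] := IHn y; first by case/faceP: yx; rewrite rx => _ [].
by exists (x |: h); apply: flag_cons yx hF.
Qed.

Lemma flag_has_face x g : (0 < rk x)%N -> g \in flags (cl x) ->
  exists2 y, y \in g & y \in faces x.
Proof.
case rx: (rk x) => [//|m] _ gF; have xg := flag_top gF.
case/flagsP: gF => gx _ /(_ m).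
rewrite rx leqnSn => /(_ isT)/eqP/cards1P[y /setP/(_ y)].
rewrite !inE eqxx => /andP[yg /eqP ry]; exists y => //.
apply/faceP; rewrite ry rx; split=> //.
rewrite lt_neqAle gx // andbT; apply/eqP => yx; move: ry.
by rewrite yx rx => /eqP; rewrite gtn_eqF.
Qed.

Lemma flag_graph_cons x y h h' : y \in faces x ->
  flag_graph (cl y) h h' -> flag_graph (cl x) (x |: h) (x |: h').
Proof.
move=> yx /and3P[hF h'F /andP[hh' h'h]].
have xh := face_notin_flag yx hF; have xh' := face_notin_flag yx h'F.
have cancel (A B : {set S}) : x \notin A -> (x |: A) :\: (x |: B) = A :\: B.
  move=> xA; apply/setP => z; rewrite !inE.
  by have [->|] := eqVneq z x; rewrite ?(negPf xA) ?andbF.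
by apply/and3P; rewrite /adjacent !cancel // hh' h'h !(flag_cons yx).
Qed.

Lemma flag_connect_cons x y h h' : y \in faces x ->
  connect (flag_graph (cl y)) h h' ->
  connect (flag_graph (cl x)) (x |: h) (x |: h').
Proof.
move=> yx /connectP[p pP ->] {h'}.
elim: p h pP => [|h' p IHp] h /=; first by rewrite connect0.
case/andP=> hh' /IHp; apply: connect_trans.
exact/connect1/(flag_graph_cons yx).
Qed.

Lemma flag_swap x y y' h : y \in faces x -> y' \in faces x -> y != y' ->
  y |: h \in flags (cl y) -> y' |: h \in flags (cl y') ->
  flag_graph (cl x) (x |: (y |: h)) (x |: (y' |: h)).
Proof.
move=> yx y'x yy' yF y'F; have xy := face_notin_flag yx yF.
have xy' := face_notin_flag y'x y'F.
have new u v : u \in faces x -> v \in faces x -> u != v ->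
    v |: h \in flags (cl v) -> u \notin h.
  move=> /faceP[_ ru] /faceP[_ rv] uv /flagsP[vh _ _]; apply/negP => uh.
  suff : u = v by apply/eqP.
  by apply: eq_of_rk; [apply: vh; rewrite setU1r|apply: succn_inj; rewrite -ru].
have diff u v : u != v -> u \notin h -> x \notin u |: h ->
    #|(x |: (u |: h)) :\: (x |: (v |: h))| == 1%N.
  move=> uv uh xu; apply/cards1P; exists u; apply/setP => z; rewrite !inE.
  have [->|zu] := eqVneq z u; last by case: (z == x); case: (z == v); case: (z \in h).
  rewrite (negPf uv) (negPf uh) !orbF orbT andbT; apply: contraNneq xu => ->.
  exact: setU11.
rewrite /flag_graph /= (flag_cons yx) // (flag_cons y'x) // /adjacent.
by rewrite !diff // 1?eq_sym // (new y y', new y' y) // eq_sym.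
Qed.

(** Strong connectivity of the facets is all that an induction on the rank needs:
    two flags through distinct faces are joined by moving each of them, inside
    its face, to one that continues by a common [h], and then exchanging the
    two faces. *)
Lemma flags_connected :
  (forall x y y', y \in faces x -> y' \in faces x -> y != y' ->
    exists2 h, y |: h \in flags (cl y) & y' |: h \in flags (cl y')) ->
  forall x, {in flags (cl x) &, forall g g', connect (flag_graph (cl x)) g g'}.
Proof.
move=> common x; elim: {x}(rk x) {-2}x (erefl (rk x)) => [|n IHn] x rx g g' gF g'F.
  by move: gF g'F; rewrite !flag_rk0 // => /eqP-> /eqP->; apply: connect0.
have IH y : y \in faces x -> {in flags (cl y) &, forall k k',
    connect (flag_graph (cl x)) (x |: k) (x |: k')}.
  move=> yx k k' kF k'F; apply: (flag_connect_cons yx); apply: IHn => //.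
  by case/faceP: yx; rewrite rx => _ [].
have x_gt0 : (0 < rk x)%N by rewrite rx.
have [y yg yx] := flag_has_face x_gt0 gF.
have [y' y'g y'x] := flag_has_face x_gt0 g'F.
have F := flag_behead yx gF yg; have F' := flag_behead y'x g'F y'g.
rewrite -(setD1K (flag_top gF)) -(setD1K (flag_top g'F)).
have [yy'|yy'] := eqVneq y y'; first by apply: (IH y) => //; rewrite yy'.
have [h hF h'F] := common x y y' yx y'x yy'.
apply: connect_trans (IH y yx _ _ F hF) _.
apply: connect_trans _ (IH y' y'x _ _ h'F F').
exact/connect1/flag_swap.
Qed.

End Flags.

Local Open Scope quotient_scope.
Local Open Scope ring_scope.

Local Notation chain S := {ffun S -> int}.

(** * Chains and the boundary operator *)

Section LinearExtension.
Context {I : finType} {V : zmodType}.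
Implicit Types (G : I -> V) (c : chain I).

Definition lin G c : V := \sum_x G x *~ c x.

Lemma lin_is_zmod_morphism G : zmod_morphism (lin G).
Proof.
by move=> b c; rewrite /lin -sumrB; apply: eq_bigr => x _; rewrite !ffunE mulrzBr.
Qed.

HB.instance Definition _ G :=
  GRing.isZmodMorphism.Build _ _ (lin G) (lin_is_zmod_morphism G).

Lemma eq_lin G G' c : (forall x, c x != 0 -> G x = G' x) -> lin G c = lin G' c.
Proof.
move=> GG'; apply: eq_bigr => x _.
by have [->|/GG'->//] := eqVneq (c x) 0; rewrite !mulr0z.
Qed.

Lemma lin_add G G' c : lin (fun x => G x + G' x) c = lin G c + lin G' c.
Proof. by rewrite /lin -big_split; apply: eq_bigr => x _; rewrite mulrzDl. Qed.

Lemma lin_opp G c : lin (fun x => - G x) c = - lin G c.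
Proof. by rewrite /lin -sumrN; apply: eq_bigr => x _; rewrite mulNrz. Qed.

Lemma lin0 c : lin (fun=> 0) c = 0.
Proof. by rewrite /lin big1 // => x _; rewrite mul0rz. Qed.

Lemma ffunMzE (f : {ffun I -> V}) n x : (f *~ n) x = f x *~ n.
Proof. by case: n => n; rewrite -?pmulrn ?NegzE ?nmulrn ?ffunE ?ffunMnE. Qed.

End LinearExtension.

Lemma raddf_lin (I : finType) (V W : zmodType) (f : {additive V -> W}) (G : I -> V) c :
  f (lin G c) = lin (fun x => f (G x)) c.
Proof. by rewrite raddf_sum; apply: eq_bigr => x _; rewrite raddfMz. Qed.

HB.instance Definition _ d (S : cccType d) (D : {set S}) i :=
  GRing.isZmodClosed.Build (chain S) (in_chains D i) (in_chains_zmod D i).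

Section Chains.
Context {d : Order.disp_t} {S : cccType d}.
Implicit Types (x y z : S) (D : {set S}) (c b : chain S).

Lemma in_chainsP D i c :
  reflect (forall x, c x != 0 -> x \in D /\ rk x = i) (c \in in_chains D i).
Proof.
apply: (iffP forallP) => cD x; first by move/implyP: (cD x) => /[apply]/andP[? /eqP].
by apply/implyP => /cD[-> ->]; rewrite eqxx.
Qed.

Lemma in_chainsW D D' i : D \subset D' ->
  {subset in_chains D i <= in_chains D' i}.
Proof.
by move=> /subsetP DD' c /in_chainsP cD; apply/in_chainsP => x /cD[/DD'].
Qed.

Lemma cell_chainE x y : cell_chain x y = (y == x)%:Z.
Proof. by rewrite ffunE. Qed.

Lemma cell_chain_in D i x : x \in D -> rk x = i -> cell_chain x \in in_chains D i.
Proof.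
by move=> xD rx; apply/in_chainsP => y; rewrite ffunE; case: (y =P x) => [->|].
Qed.

Lemma lin_cell (V : zmodType) (G : S -> V) x : lin G (cell_chain x) = G x.
Proof.
rewrite /lin (bigD1 x) //= cell_chainE eqxx big1 ?addr0 // => y /negPf yx.
by rewrite cell_chainE yx mulr0z.
Qed.

Lemma lin_cell_chain c : lin cell_chain c = c.
Proof.
apply/ffunP => y; rewrite sum_ffunE (bigD1 y) //= ffunMzE cell_chainE eqxx intz.
rewrite big1 ?addr0 // => x /negPf xy.
by rewrite ffunMzE cell_chainE eq_sym xy mul0rz.
Qed.

Lemma lin_in_chains d' (T : cccType d') (G : S -> chain T) (E : {set T}) j c :
  (forall x, c x != 0 -> G x \in in_chains E j) -> lin G c \in in_chains E j.
Proof.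
move=> GE; apply: rpred_sum => x _; have [->|/GE] := eqVneq (c x) 0.
  by rewrite mulr0z rpred0.
by apply: rpredMz.
Qed.

Definition aug c : int := \sum_x c x.

Lemma augE c : aug c = lin (fun=> 1 : int) c.
Proof. by apply: eq_bigr => x _; rewrite mulrzz mul1r. Qed.

Lemma aug_is_zmod_morphism : zmod_morphism aug.
Proof. by move=> b c; rewrite !augE raddfB. Qed.

HB.instance Definition _ :=
  GRing.isZmodMorphism.Build _ _ aug aug_is_zmod_morphism.

Lemma aug_cell x : aug (cell_chain x) = 1.
Proof. by rewrite augE lin_cell. Qed.

End Chains.

Section Boundary.
Context {d : Order.disp_t} {S : cccType d} (o : orientations S).
Implicit Types (x y z : S) (D : {set S}) (c b : chain S) (g h : {set S}).

HB.instance Definition _ := GRing.isZmodMorphism.Build _ _ (bd o) (bdB o).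

Lemma bdE c : bd o c = lin (bd_cell o) c. Proof. by []. Qed.

Lemma bd_cellE x y :
  bd_cell o x y = if y \in faces x then incidence o x y else 0.
Proof.
rewrite sum_ffunE; case: ifP => yx.
  rewrite (bigD1 y) //= ffunMzE cell_chainE eqxx intz big1 ?addr0 // => z.
  by case/andP=> _ /negPf zy; rewrite ffunMzE cell_chainE eq_sym zy mul0rz.
rewrite big1 // => z zx; rewrite ffunMzE cell_chainE.
by case: eqP zx => [<-|]; rewrite ?yx ?mul0rz.
Qed.

Lemma bd_cell_neq0 x y : bd_cell o x y != 0 -> y \in faces x.
Proof. by rewrite bd_cellE; case: ifP => //; rewrite eqxx. Qed.

Lemma bd_coef c y : bd o c y = \sum_(x | y \in faces x) incidence o x y * c x.
Proof.
rewrite sum_ffunE [RHS]big_mkcond; apply: eq_bigr => x _.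
by rewrite ffunMzE bd_cellE; case: ifP; rewrite ?mul0rz // mulrzz.
Qed.

Lemma bd_cell_chain x : bd o (cell_chain x) = bd_cell o x.
Proof. by rewrite bdE lin_cell. Qed.

Lemma bd_cell_rk0 x : rk x = 0%N -> bd_cell o x = 0.
Proof.
move=> x0; apply/ffunP => y; rewrite bd_cellE ffunE.
by case: ifP => // /faceP[_]; rewrite x0.
Qed.

Lemma bd_in_chains D i c : (forall x y, x \in D -> y \in faces x -> y \in D) ->
  c \in in_chains D i.+1 -> bd o c \in in_chains D i.
Proof.
move=> Ddown /in_chainsP cD; apply: lin_in_chains => x /cD[xD rx].
apply/in_chainsP => y /bd_cell_neq0 yx; split; first exact: Ddown yx.
by case/faceP: yx; rewrite rx => _ [].
Qed.

Lemma orient_sqr x g : g \in flags (cl x) -> o x g * o x g = 1.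
Proof. by move=> gF; case: ((orientP o x).1 g gF) => ->; rewrite ?mulrNN mulr1. Qed.

Context (flag_connected : forall x : S, {in flags (cl x) &,
  forall g g', connect (flag_graph (cl x)) g g'}).

(** The incidence number is read off one flag of [x] through [y]. Passing to an
    adjacent flag of [y] negates both signs in the product, and the flags of
    [y] are connected, so every flag gives the same value. *)
Lemma incidenceE x y h : y \in faces x -> h \in flags (cl y) ->
  incidence o x y = o x (x |: h) * o y h.
Proof.
move=> yx hF; rewrite /incidence; case: pickP => [g /andP[gF yg]|none]; last first.
  have := none (x |: h); rewrite (flag_cons yx) //=.
  by rewrite setU1r // flag_top.
have g'F := flag_behead yx gF yg.
rewrite -{1}(setD1K (flag_top gF)); move: (g :\ x) g'F => {gF yg}g gF.
have /connectP[p] := flag_connected gF hF.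
elim: p g {gF} => [|k p IHp] g /=; first by move=> _ ->.
case/andP=> gk kp hE; rewrite -(IHp k) //.
rewrite ((orientP o y).2 _ _ gk) ((orientP o x).2 _ _ (flag_graph_cons yx gk)).
by rewrite mulrNN.
Qed.

Lemma incidence_sqr x y : y \in faces x -> incidence o x y * incidence o x y = 1.
Proof.
move=> yx; have [h hF] := flag_exists y; rewrite (incidenceE yx hF).
by rewrite mulrACA !orient_sqr ?mulr1 ?(flag_cons yx).
Qed.

(** Exchanging the second cell of a flag reverses the orientation of the first.
    With [h] a flag of a cell of corank two this is the cancellation behind
    the vanishing of the iterated boundary; with [h] empty it says that the two
    ends of an edge occur with opposite signs. *)
Lemma incidence_swap x y y' h : y \in faces x -> y' \in faces x -> y != y' ->
  y |: h \in flags (cl y) -> y' |: h \in flags (cl y') ->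
  incidence o x y * o y (y |: h) = - (incidence o x y' * o y' (y' |: h)).
Proof.
move=> yx y'x yy' hF h'F; rewrite (incidenceE yx hF) (incidenceE y'x h'F).
rewrite -!mulrA !orient_sqr // !mulr1.
by rewrite ((orientP o x).2 _ _ (flag_swap yx y'x yy' hF h'F)) opprK.
Qed.

(** The cells between [x] and [z] of corank two come in a pair, and the two
    paths from [x] to [z] have opposite signs. *)
Lemma bd_bd_cell x : bd o (bd_cell o x) = 0.
Proof.
apply/ffunP => z; rewrite bd_coef ffunE.
(* The cells [y] that contribute to the coefficient of [z]. *)
pose M := faces x :&: cofaces_of rk z.
rewrite (eq_bigr (fun y => if y \in faces x then
    incidence o y z * incidence o x y else 0)); last first.
  by move=> y _; rewrite bd_cellE; case: ifP; rewrite ?mulr0.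
rewrite -big_mkcondr /= (eq_bigl (mem M)); last first.
  by move=> y; rewrite !inE andbC.
have [->|[y]] := set_0Vmem M; first by rewrite big_set0.
rewrite in_setI => /andP[/faceP[yx rx]]; rewrite in_set => /faceP[zy ry].
have [||y1 [y2 [y12 ME _]]] := @rk_diamond _ _ x z; first exact: lt_trans yx.
  by rewrite rx ry.
rewrite /M /faces ME big_setU1 ?inE //= big_set1.
have yP y' : y' \in [set y1; y2] -> y' \in faces x /\ z \in faces y'.
  by rewrite -ME in_setI => /andP[? y'z]; split; last by rewrite in_set in y'z.
have [[y1x zy1] [y2x zy2]] := (yP y1 (set21 _ _), yP y2 (set22 _ _)).
have [h hF] := flag_exists z.
rewrite (incidenceE zy1 hF) (incidenceE zy2 hF).
rewrite [_ * incidence o x y1]mulrC [_ * incidence o x y2]mulrC !mulrA -mulrDl.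
rewrite (@incidence_swap x y1 y2) ?(flag_cons zy1) ?(flag_cons zy2) //.
by rewrite addNr mul0r.
Qed.

Lemma bd_bd c : bd o (bd o c) = 0.
Proof.
rewrite [bd o c]bdE raddf_lin (eq_lin (G' := fun=> 0)) ?lin0 // => x _.
exact: bd_bd_cell.
Qed.

Context (edge_faces : forall e : S, rk e = 1%N -> #|faces e| = 2%N).

Lemma aug_bd_cell e : rk e = 1%N -> aug (bd_cell o e) = 0.
Proof.
move=> e1; have /eqP/cards2P[u [v [uv eE]]] := edge_faces e1.
have vertex w : w \in faces e -> rk w = 0%N.
  by case/faceP=> _; rewrite e1 => -[].
have [ue ve] : u \in faces e /\ v \in faces e by rewrite eE set21 set22.
rewrite /aug (eq_bigr _ (fun y _ => bd_cellE e y)) -big_mkcond /= eE.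
rewrite big_setU1 ?inE //= big_set1.
have := @incidence_swap e u v set0 ue ve uv.
rewrite !setU0 !flag_rk0 ?eqxx ?vertex // !orient_vertex ?vertex // !mulr1.
by move=> -> //; rewrite addNr.
Qed.

Lemma aug_bd D c : c \in in_chains D 1 -> aug (bd o c) = 0.
Proof.
move=> /in_chainsP cD; rewrite bdE raddf_lin (eq_lin (G' := fun=> 0)) ?lin0 //.
by move=> x /cD[_]; apply: aug_bd_cell.
Qed.

End Boundary.

(** * Acyclic carriers *)

Definition augmented_complex d (S : cccType d) (o : orientations S) :=
  (forall x, bd o (bd_cell o x) = 0) /\
  (forall e, rk e = 1%N -> aug (bd_cell o e) = 0).

(** Vanishing of the reduced homology of [D], with a chain of augmentation one
    in place of a base point. *)
Definition aug_acyclic d (S : cccType d) (o : orientations S) (D : {set S}) :=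
  (exists2 c, c \in in_chains D 0 & aug c = 1) /\
  forall i c, c \in in_chains D i -> bd o c = 0 -> (i = 0%N -> aug c = 0) ->
    exists2 b, b \in in_chains D i.+1 & bd o b = c.

(** Construction of a function on cells, each value being chosen relative to the
    values on the faces, while the choice may be possible only because all
    values at lower rank are already as required. The relation [P G x v] reads
    as: [v] is an admissible value at [x], given [G] below [x]. *)
Lemma rank_recursion d (S : cccType d) (V : Type) (v0 : V)
    (P : (S -> V) -> S -> V -> Prop) :
  (forall G G' x v, {in faces x, G =1 G'} -> P G x v -> P G' x v) ->
  (forall G x, (forall y, (rk y < rk x)%N -> P G y (G y)) -> exists v, P G x v) ->
  exists G, forall x, P G x (G x).
Proof.
move=> Pext Pstep.
suff [G GP] : exists G, forall x, (rk x < (\max_(x : S) rk x).+1)%N -> P G x (G x).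
  by exists G => x; apply: GP; rewrite ltnS leq_bigmax.
elim: _.+1 => [|m [G GP]]; first by exists (fun=> v0).
have /choice[f fP] : forall x, exists v, rk x = m -> P G x v.
  move=> x; have [rx|rx] := eqVneq (rk x) m; last first.
    by exists v0 => /eqP; rewrite (negPf rx).
  by have [|v Pv] := Pstep G x; [rewrite rx|exists v].
exists (fun x => if rk x == m then f x else G x) => x; rewrite ltnS => xm.
have ext y : y \in faces x -> G y = if rk y == m then f y else G y.
  by case/faceP=> _ ry; rewrite ltn_eqF // -ry.
apply: (Pext G) => //; case: eqP => [/fP//|/eqP rx].
by apply: GP; rewrite ltn_neqAle rx.
Qed.

Section Carriers.
Context {dS dT : Order.disp_t} {S : cccType dS} {T : cccType dT}.
Context (oS : orientations S) (oT : orientations T).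
Context (Phi : S -> {set T}).
Context (augS : augmented_complex oS).
Context (Phi_face : forall x y, y \in faces x -> Phi y \subset Phi x).
Context (Phi_acyclic : forall x, aug_acyclic oT (Phi x)).

Definition carried_map (f : S -> chain T) := forall x,
  [/\ f x \in in_chains (Phi x) (rk x), bd oT (f x) = lin f (bd_cell oS x) &
      rk x = 0%N -> aug (f x) = 1].

Lemma lin_bd_cell_in (G : S -> chain T) x k m : rk x = m.+1 ->
  (forall y, (rk y < rk x)%N -> G y \in in_chains (Phi y) (k + rk y)) ->
  lin G (bd_cell oS x) \in in_chains (Phi x) (k + m).
Proof.
move=> rx GP; apply: lin_in_chains => y /bd_cell_neq0 yx.
have /faceP[_ ry] := yx; have <- : rk y = m by move: ry; rewrite rx => -[].
by apply: (in_chainsW (Phi_face yx)); apply: GP; rewrite ry.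
Qed.

(** Over the boundary of [x] the map is already defined and its value is a
    cycle of the acyclic [Phi x]; the image of [x] is a chain filling it. At
    vertices any chain of augmentation one will do, and at edges the
    augmentation of the cycle is that of the boundary of the edge. *)
Lemma carried_map_exists : exists f, carried_map f.
Proof.
have [bdS aug1] := augS.
apply: (@rank_recursion _ S (chain T) 0 (fun f x c =>
  [/\ c \in in_chains (Phi x) (rk x), bd oT c = lin f (bd_cell oS x) &
      rk x = 0%N -> aug c = 1])) => [f f' x c ff' [cx bdc c0]|f x fP].
  by split=> //; rewrite bdc; apply: eq_lin => y /bd_cell_neq0/ff'.
have [[v vx v1] acyc] := Phi_acyclic x.
case rx: (rk x) => [|m].
  exists v; split=> //; rewrite bd_cell_rk0 // raddf0.
  rewrite bdE (eq_lin (G' := fun=> 0)) ?lin0 // => y.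
  by case/(in_chainsP _ _ _ vx)=> _; apply: bd_cell_rk0.
have [||m0|c cx bdc] := acyc m (lin f (bd_cell oS x)).
- by apply: (lin_bd_cell_in (k := 0%N) rx) => y /fP[].
- rewrite raddf_lin (eq_lin (G' := fun y => lin f (bd_cell oS y))).
    by rewrite -(raddf_lin (lin f)) -bdE bdS raddf0.
  by move=> y /bd_cell_neq0/faceP[_ ry]; have [] := fP y; rewrite ?ry.
- rewrite raddf_lin (eq_lin (G' := fun=> 1)) -?augE ?aug1 ?rx ?m0 //.
  move=> y /bd_cell_neq0/faceP[_ ry]; have [|_ _ fy1] := fP y; first by rewrite ry.
  by apply: fy1; move: ry; rewrite rx m0 => -[].
by exists c.
Qed.

(** At [x] one fills [f x - h (bd x)], which is a cycle because [f] commutes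
    with the boundary and [h] is a homotopy at lower rank. Here [f] is the
    difference of two carried maps, whence the augmentation zero. *)
Lemma carried_homotopy (f : S -> chain T) :
  (forall x, [/\ f x \in in_chains (Phi x) (rk x),
    bd oT (f x) = lin f (bd_cell oS x) & rk x = 0%N -> aug (f x) = 0]) ->
  exists h : S -> chain T, forall x, h x \in in_chains (Phi x) (rk x).+1 /\
    bd oT (h x) = f x - lin h (bd_cell oS x).
Proof.
have [bdS _] := augS => fP.
apply: (@rank_recursion _ S (chain T) 0 (fun h x c =>
    c \in in_chains (Phi x) (rk x).+1 /\ bd oT c = f x - lin h (bd_cell oS x)))
  => [h h' x c hh' [cx bdc]|h x hP].
  by split=> //; rewrite bdc; congr (_ - _); apply: eq_lin => y /bd_cell_neq0/hh'.
have [_ acyc] := Phi_acyclic x; have [fx bdf f0] := fP x.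
have [||x0|b bx bdb] := acyc (rk x) (f x - lin h (bd_cell oS x)); last 1 first.
- by exists b.
- apply: rpredB => //; case rx: (rk x) => [|m].
    by rewrite bd_cell_rk0 // raddf0 rpred0.
  by apply: (lin_bd_cell_in (k := 1%N) rx) => y /hP[].
- rewrite raddfB /= bdf (raddf_lin (bd oT)).
  rewrite [X in _ - X](eq_lin (G' := fun y => f y + - lin h (bd_cell oS y))).
    rewrite lin_add lin_opp -(raddf_lin (lin h)) -bdE bdS raddf0 oppr0 addr0.
    by rewrite subrr.
  by move=> y /bd_cell_neq0/faceP[_ ry]; case: (hP y) => //; rewrite ry.
by rewrite raddfB /= f0 // bd_cell_rk0 // !raddf0.
Qed.

Lemma carried_maps_homotopic f f' : carried_map f -> carried_map f' ->
  forall i c, c \in in_chains setT i -> bd oS c = 0 ->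
    exists2 b, b \in in_chains setT i.+1 & bd oT b = lin f c - lin f' c.
Proof.
move=> fP f'P i c /in_chainsP cS c0.
have [|h hP] := @carried_homotopy (fun x => f x - f' x).
  move=> x; have [fx bdf f1] := fP x; have [f'x bdf' f'1] := f'P x; split.
  - exact: rpredB.
  - by rewrite raddfB /= bdf bdf' lin_add lin_opp.
  - by move=> x0; rewrite raddfB /= f1 // f'1 // subrr.
exists (lin h c).
  apply: lin_in_chains => x /cS[_ <-]; have [+ _] := hP x.
  exact/in_chainsW/subsetT.
rewrite (raddf_lin (bd oT)).
rewrite (eq_lin (G' := fun x => (f x + - f' x) + - lin h (bd_cell oS x))).
  by rewrite !lin_add !lin_opp -(raddf_lin (lin h)) -bdE c0 raddf0 subr0.
by move=> x _; case: (hP x).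
Qed.

Lemma carried_bd f : carried_map f ->
  {morph lin f : c / bd oS c >-> bd oT c}.
Proof.
move=> fP c; rewrite (raddf_lin (bd oT)) bdE (raddf_lin (lin f)).
by apply: eq_lin => x _; case: (fP x).
Qed.

Lemma carried_in_chains f i : carried_map f ->
  {homo lin f : c / c \in in_chains setT i >-> c \in in_chains setT i}.
Proof.
move=> fP c /in_chainsP cS; apply: lin_in_chains => x /cS[_ <-].
by have [+ _ _] := fP x; apply/in_chainsW/subsetT.
Qed.

End Carriers.

Section CarriedMaps.
Context {dS dT dU : Order.disp_t}.
Context {S : cccType dS} {T : cccType dT} {U : cccType dU}.
Context (oS : orientations S) (oT : orientations T) (oU : orientations U).

Lemma carried_id (Phi : S -> {set S}) : (forall x, x \in Phi x) ->
  carried_map oS oS Phi cell_chain.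
Proof.
move=> xPhi x; split; first exact: cell_chain_in.
  by rewrite bd_cell_chain lin_cell_chain.
by rewrite aug_cell.
Qed.

Lemma carried_comp (Phi : S -> {set T}) (Psi : T -> {set U}) (Xi : S -> {set U})
    f g :
  (forall x y, y \in Phi x -> Psi y \subset Xi x) ->
  carried_map oS oT Phi f -> carried_map oT oU Psi g ->
  carried_map oS oU Xi (fun x => lin g (f x)).
Proof.
move=> sub fP gP x; have [/in_chainsP fx bdf f1] := fP x; split.
- apply: lin_in_chains => y /fx[/sub yx <-]; have [gy _ _] := gP y.
  exact: (in_chainsW yx).
- by rewrite -(carried_bd gP) bdf (raddf_lin (lin g)).
move=> x0; rewrite raddf_lin (eq_lin (G' := fun=> 1)) -?augE ?f1 //.
by move=> y /fx[_ y0]; have [_ _ g1] := gP y; apply: g1; rewrite y0.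
Qed.

End CarriedMaps.

(** * Homotopy equivalences and homology *)

Section HomologyClasses.
Context {d : Order.disp_t} {S : cccType d} (o : orientations S).
Context (D : {set S}) (i : nat).
Local Notation Z := (Defs.cycle o D i).
Local Notation H := (homology_of o D i).

Definition hclass (z : Z) : H := \pi z.

Lemma hclassB : {morph hclass : z z' / z - z'}.
Proof. by move=> z z'; rewrite /hclass !piE. Qed.

HB.instance Definition _ :=
  GRing.isZmodMorphism.Build _ _ hclass hclassB.

Lemma hclass_repr (h : H) : hclass (repr h) = h.
Proof. exact: reprK. Qed.

Lemma cycleP (z : Z) : val z \in in_chains D i /\ bd o (val z) = 0.
Proof. by have /andP[zD /eqP] := valP z. Qed.

Lemma val_cycleB (z z' : Z) : val (z - z') = val z - val z'.
Proof. exact: (raddfB val). Qed.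

Lemma val_cycleMz (z : Z) n : val (z *~ n) = val z *~ n.
Proof. exact: (raddfMz val). Qed.

Lemma hclass_eqP (z z' : Z) :
  hclass z = hclass z' <-> exists2 b, b \in in_chains D i.+1 & bd o b = val z - val z'.
Proof.
rewrite /hclass; split=> [/eqP|[b bD bE]]; last apply/eqP; rewrite -Quotient.idealrBE.
  by case/asboolP=> b [bD bE]; exists b; rewrite // bE -val_cycleB.
by apply/asboolP; exists b; split=> //; rewrite bE -val_cycleB.
Qed.

Lemma cycle_of c : c \in in_chains D i -> bd o c = 0 -> exists z : Z, val z = c.
Proof.
move=> cD c0; have cZ : c \in is_cycle o D i by apply/andP; rewrite c0 eqxx.
by exists (Cycle cZ).
Qed.

End HomologyClasses.

Section InducedMap.
Context {dS dT : Order.disp_t} {S : cccType dS} {T : cccType dT}.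
Context (oS : orientations S) (oT : orientations T).
Context (D : {set S}) (E : {set T}) (F : {additive chain S -> chain T}).
Context (F_deg : forall i, {homo F : c / c \in in_chains D i >-> c \in in_chains E i}).
Context (F_bd : {morph F : c / bd oS c >-> bd oT c}).

Lemma homology_map i :
  exists f : {additive homology_of oS D i -> homology_of oT E i},
    forall (z : Defs.cycle oS D i) (z' : Defs.cycle oT E i),
      val z' = F (val z) -> f (hclass z) = hclass z'.
Proof.
have /choice[Fz FzE] : forall z : Defs.cycle oS D i,
    exists z' : Defs.cycle oT E i, val z' = F (val z).
  move=> z; have [zD z0] := cycleP z.
  by apply: cycle_of; [apply: F_deg|rewrite -F_bd z0 raddf0].
pose f (h : homology_of oS D i) : homology_of oT E i := hclass (Fz (repr h)).
have fE z z' : val z' = F (val z) -> f (hclass z) = hclass z'.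
  move=> z'E; apply/hclass_eqP.
  have /hclass_eqP[b bD bE] := hclass_repr (hclass z).
  by exists (F b); [apply: F_deg|rewrite -F_bd bE raddfB FzE z'E].
have f_additive : zmod_morphism f.
  move=> h h'; rewrite -(hclass_repr h) -(hclass_repr h') -hclassB.
  rewrite (fE (repr h) _ (FzE _)) (fE (repr h') _ (FzE _)).
  by rewrite -hclassB; apply: fE; rewrite !val_cycleB !FzE raddfB.
pose f_morph := GRing.isZmodMorphism.Build _ _ f f_additive.
pose fA : {additive homology_of oS D i -> homology_of oT E i} := HB.pack f f_morph.
by exists fA.
Qed.

End InducedMap.

Lemma homology_iso dS dT (S : cccType dS) (T : cccType dT)
    (oS : orientations S) (oT : orientations T) (D : {set S}) (E : {set T})
    (F : {additive chain S -> chain T}) (G : {additive chain T -> chain S}) :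
  (forall i, {homo F : c / c \in in_chains D i >-> c \in in_chains E i}) ->
  (forall i, {homo G : c / c \in in_chains E i >-> c \in in_chains D i}) ->
  {morph F : c / bd oS c >-> bd oT c} -> {morph G : c / bd oT c >-> bd oS c} ->
  (forall i c, c \in in_chains D i -> bd oS c = 0 ->
    exists2 b, b \in in_chains D i.+1 & bd oS b = G (F c) - c) ->
  (forall i c, c \in in_chains E i -> bd oT c = 0 ->
    exists2 b, b \in in_chains E i.+1 & bd oT b = F (G c) - c) ->
  forall i, zmod_iso (homology_of oS D i) (homology_of oT E i).
Proof.
move=> F_deg G_deg F_bd G_bd GF FG i.
have [f fE] := homology_map F_deg F_bd i.
have [g gE] := homology_map G_deg G_bd i.
have push (z : Defs.cycle oS D i) : exists z' : Defs.cycle oT E i, val z' = F (val z).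
  have [zD z0] := cycleP z.
  by apply: cycle_of; [apply: F_deg|rewrite -F_bd z0 raddf0].
have pull (z : Defs.cycle oT E i) : exists z' : Defs.cycle oS D i, val z' = G (val z).
  have [zD z0] := cycleP z.
  by apply: cycle_of; [apply: G_deg|rewrite -G_bd z0 raddf0].
exists f; exists g => h; rewrite -(hclass_repr h); move: (repr h) => z.
  have [z1 z1E] := push z; have [z2 z2E] := pull z1.
  rewrite (fE _ _ z1E) (gE _ _ z2E); apply/hclass_eqP.
  have [zD z0] := cycleP z; have [b bD bE] := GF i _ zD z0.
  by exists b; rewrite // bE z2E z1E.
have [z1 z1E] := pull z; have [z2 z2E] := push z1.
rewrite (gE _ _ z1E) (fE _ _ z2E); apply/hclass_eqP.
have [zE z0] := cycleP z; have [b bE' bE] := FG i _ zE z0.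
by exists b; rewrite // bE z2E z1E.
Qed.

Section CellAcyclicity.
Context {d : Order.disp_t} {S : cccType d} (o : orientations S).
Context (aug_bd0 : forall (D : {set S}) c, c \in in_chains D 1 -> aug (bd o c) = 0).

(** The hypothesis on [H_0] only provides some isomorphism to the integers.
    It is a nonzero multiple of the augmentation, because the
    augmentation is a homomorphism on [H_0] taking the value one at a vertex;
    so the two have the same kernel. *)
Lemma acyclic_aug_acyclic (D : {set S}) v : v \in D -> rk v = 0%N ->
  acyclic o D -> aug_acyclic o D.
Proof.
move=> vD v0 [acyc [f [g fK gK]]].
split; first by exists (cell_chain v); rewrite ?aug_cell ?cell_chain_in.
have null i (z : Defs.cycle o D i) : hclass z = 0 ->
    exists2 b, b \in in_chains D i.+1 & bd o b = val z.
  move=> z0; have /hclass_eqP[b bD bE] : hclass z = hclass (0 : Defs.cycle o D i).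
    by rewrite z0 raddf0.
  by exists b; rewrite // bE (raddf0 val) subr0.
move=> [|i] c cD c0 aug0; have [z zE] := cycle_of cD c0; rewrite -zE; last first.
  by apply: null; apply: acyc.
apply: null; have [z0 z0E] : exists z0, hclass z0 = g 1.
  by exists (repr (g 1)); apply: hclass_repr.
have augE z' : aug (val z') = aug (val z0) * f (hclass z').
  have /hclass_eqP[b bD bE] : hclass z' = hclass (z0 *~ f (hclass z')).
    by apply: (can_inj fK); rewrite raddfMz /= z0E raddfMz /= gK intz.
  rewrite -[LHS]subr0 -(aug_bd0 bD) bE val_cycleMz raddfB raddfMz /= opprB.
  by rewrite addrC subrK mulrzz.
have aug_z0 : aug (val z0) != 0.
  have [||zv zvE] := @cycle_of _ S o D 0 (cell_chain v).
  - exact: cell_chain_in.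
  - by rewrite bd_cell_chain bd_cell_rk0.
  by apply: contra_eq_neq (augE zv) => ->; rewrite zvE aug_cell mul0r.
apply: (can_inj fK); rewrite raddf0; apply/eqP.
have /eqP := augE z; rewrite zE aug0 // eq_sym mulf_eq0 (negPf aug_z0) /=.
by [].
Qed.

End CellAcyclicity.

(** * The barycentric subdivision *)

Section BarycentricSubdivision.
Context {d : Order.disp_t} {S : cccType d}.
Implicit Types (a b e : bary S) (x y : S).

Lemma bary_faceE a b :
  (b \in faces a) = (bary_val b \subset a) && (#|bary_val a| == #|bary_val b|.+1).
Proof. exact: bary_facesE. Qed.

Lemma bary_inj a b : bary_val a = bary_val b -> a = b.
Proof. exact: val_inj. Qed.

Lemma bary_coface x b e : b \in faces e -> x \in bary_val e ->
  x \notin bary_val b -> bary_val e = x |: b.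
Proof.
rewrite bary_faceE => /andP[be /eqP ce] xe xb.
by apply/eqP; rewrite eq_sym eqEcard subUset sub1set xe be cardsU1 xb ce leqnn.
Qed.

(** Distinct facets of a simplex meet in a simplex of corank two, or in the empty
    set for an edge, and a flag of the intersection continues both. *)
Lemma bary_flags_connected a :
  {in flags (cl a) &, forall g g', connect (flag_graph (cl a)) g g'}.
Proof.
apply: flags_connected => {}a b b'.
rewrite !bary_faceE => /andP[ba /eqP cb] /andP[b'a /eqP cb'] bb'.
have bb'_card : #|bary_val b'| = #|bary_val b| by apply: succn_inj; rewrite -cb.
have cI : #|bary_val b| = #|bary_val b :&: b'|.+1.
  have /eqP U : bary_val b :|: b' == a.
    rewrite eqEcard subUset ba b'a /= cb; apply: proper_card.
    rewrite properE subsetUl subUset subxx /=.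
    apply: contra bb' => b'b; apply/eqP/bary_inj/eqP.
    by rewrite eq_sym eqEcard b'b bb'_card /=.
  have := cardsUI (bary_val b) b'; rewrite U cb bb'_card addSnnS.
  by move/addnI.
have [I0|I0] := eqVneq (bary_val b :&: b') set0.
  exists set0; rewrite setU0 flag_rk0 //.
    by apply: succn_inj; rewrite -bary_cardE cI I0 cards0.
  by apply: succn_inj; rewrite -bary_cardE bb'_card cI I0 cards0.
have [c cE] := bary_sub I0 (subsetIl _ _).
have [h hF] := flag_exists c.
exists h; apply: flag_cons hF; rewrite bary_faceE cE.
  by rewrite subsetIl cI /=.
by rewrite subsetIr bb'_card cI /=.
Qed.

Lemma bary_edge_faces e : rk e = 1%N -> #|faces e| = 2%N.
Proof.
move=> e1; have ce : #|bary_val e| = 2%N by rewrite bary_cardE e1.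
have /eqP/cards2P[u [v [uv eE]]] := ce.
have sub w : w \in bary_val e -> {b : bary S | b = [set w] :> {set S}}.
  move=> we; have w0 : [set w] != set0 by apply/set0Pn; exists w; rewrite set11.
  by apply: (bary_sub w0 (a := e)); rewrite sub1set.
have [|bu buE] := sub u; first by rewrite eE set21.
have [|bv bvE] := sub v; first by rewrite eE set22.
apply/eqP/cards2P; exists bu, bv; split.
  by apply: contra uv => /eqP b; rewrite -in_set1 -bvE -b buE set11.
apply/setP => b; rewrite bary_faceE ce in_set2 eqSS eq_sym eE.
apply/andP/orP=> [[be /cards1P[w bE]]|[]/eqP->].
- move: be; rewrite bE sub1set => /set2P[] wE; [left|right];
    by apply/eqP/bary_inj; rewrite bE wE ?buE ?bvE.
- by rewrite buE cards1 sub1set set21.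
- by rewrite bvE cards1 sub1set set22.
Qed.

Context (o : orientations (bary S)).

Definition bary_cl x : {set bary S} := [set a | bary_val a \subset cl x].

Lemma bary_clE x a : (a \in bary_cl x) = (bary_val a \subset cl x).
Proof. by rewrite inE. Qed.

Lemma bary_cl_face x a b : a \in bary_cl x -> b \in faces a -> b \in bary_cl x.
Proof.
by rewrite !bary_clE bary_faceE => ax /andP[/subset_trans+ _]; apply.
Qed.

Lemma bary_vertex x : {a : bary S | a = [set x] :> {set S}}.
Proof.
suff xP : ([set x] != set0) && is_chain [set x] by exists (Bary xP).
apply/andP; split; first by apply/set0Pn; exists x; rewrite set11.
by apply/forall_inP => y /set1P->; apply/forall_inP => z /set1P->; apply: comparablexx.
Qed.

Lemma bary_cone x a : a \in bary_cl x -> {e : bary S | e = x |: a :> {set S}}.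
Proof.
rewrite bary_clE => /subsetP ax.
suff xP : (x |: bary_val a != set0) && is_chain (x |: bary_val a).
  by exists (Bary xP).
have [_ /forall_inP ca] := baryP a.
have lex y : y \in x |: bary_val a -> (y <= x)%O.
  by case/setU1P=> [->//|/ax]; rewrite inE.
apply/andP; split; first by apply/set0Pn; exists x; rewrite setU11.
apply/forall_inP => y yP; apply/forall_inP => z zP.
case/setU1P: (yP) => [->|ya]; first by rewrite comparable_sym le_comparable ?lex.
case/setU1P: (zP) => [->|za]; first by rewrite le_comparable ?lex.
by have /forall_inP := ca y ya; apply.
Qed.

(** The join with the vertex [x], up to sign: as the sum has at most one term,
    for [a] the simplex [e] without [x], this takes the value of [c] at [a] to [e],
    with the sign that makes [bd_cone_coef] hold. *)
Definition cone x (c : chain (bary S)) : chain (bary S) :=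
  [ffun e => if x \in bary_val e then
    \sum_(a in faces e | x \notin bary_val a) incidence o e a * c a else 0].

Lemma cone_coef x c e a : a \in faces e -> x \in bary_val e ->
  x \notin bary_val a -> cone x c e = incidence o e a * c a.
Proof.
move=> ae xe xa; rewrite ffunE xe (bigD1 a) ?ae //= big1 ?addr0 // => b.
case/andP=> /andP[be xb] /eqP[]; apply: bary_inj.
by rewrite -(setU1K xa) -(setU1K xb) -(bary_coface ae) -?(bary_coface be).
Qed.

Lemma cone_in_chains x i c :
  c \in in_chains (bary_cl x) i -> cone x c \in in_chains (bary_cl x) i.+1.
Proof.
move=> /in_chainsP cx; apply/in_chainsP => e; rewrite ffunE.
case: ifP => [xe|]; last by rewrite eqxx.
have [a /andP[ae xa]|none] := pickP [pred a in faces e | x \notin bary_val a]; last first.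
  by rewrite big_pred0 ?eqxx.
have -> : \sum_(b in faces e | x \notin bary_val b) incidence o e b * c b =
    incidence o e a * c a by rewrite -(cone_coef c ae xe xa) ffunE xe.
rewrite mulf_eq0 negb_or => /andP[_ /cx[ax <-]].
split; last by case/faceP: ae.
by move: ax; rewrite !bary_clE (bary_coface ae xe xa) subUset sub1set inE lexx.
Qed.

(** A simplex [a] of the subdivided closure of [x] that misses [x] has only one
    coface through [x], the simplex joining [a] to [x], and incidence numbers
    are signs. *)
Lemma bd_cone_coef x i c a : c \in in_chains (bary_cl x) i ->
  x \notin bary_val a -> bd o (cone x c) a = c a.
Proof.
move=> cx xa; have [ax|ax] := boolP (a \in bary_cl x); last first.
  have out (b : chain (bary S)) : b \in in_chains (bary_cl x) i -> b a = 0.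
    by move/in_chainsP=> bx; apply: contraNeq ax => /bx[].
  rewrite !out //; apply: bd_in_chains (cone_in_chains cx).
  exact: bary_cl_face.
have [e eE] := bary_cone ax.
have ae : a \in faces e by rewrite bary_faceE eE subsetU1 cardsU1 xa /=.
have xe : x \in bary_val e by rewrite eE setU11.
rewrite bd_coef (bigD1 e) //= big1 => [|b /andP[ab be]].
  rewrite addr0 (cone_coef c ae xe xa) mulrA incidence_sqr ?mul1r //.
  exact: bary_flags_connected.
rewrite ffunE; case: ifP => xb; rewrite ?mulr0 //.
by case/eqP: be; apply: bary_inj; rewrite eE; apply: bary_coface.
Qed.

Lemma bary_bd_bd c : bd o (bd o c) = 0.
Proof. exact/bd_bd/bary_flags_connected. Qed.

Lemma bary_aug_bd (D : {set bary S}) c : c \in in_chains D 1 -> aug (bd o c) = 0.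
Proof. by apply: aug_bd; [apply: bary_flags_connected|apply: bary_edge_faces]. Qed.

Lemma bary_augmented : augmented_complex o.
Proof.
split; first exact/bd_bd_cell/bary_flags_connected.
by apply: aug_bd_cell; [apply: bary_flags_connected|apply: bary_edge_faces].
Qed.

(** Subtracting from a cycle the boundary of its cone leaves a cycle [r] whose
    simplices all contain [x]. Such a cycle is zero: the face of [a] opposite
    to [x] lies in no other simplex containing [x], so its coefficient in the
    boundary of [r] is, up to sign, the coefficient of [a] in [r]. In degree
    zero, where that face is empty, the augmentation takes its place. *)
Lemma bary_cl_aug_acyclic x : aug_acyclic o (bary_cl x).
Proof.
have [v vE] := bary_vertex x.
have v0 : rk v = 0%N by apply: succn_inj; rewrite -bary_cardE vE cards1.
split; first exists (cell_chain v); rewrite ?aug_cell //.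
  by apply: cell_chain_in; rewrite // bary_clE vE sub1set inE lexx.
move=> i c cx c0 aug0; exists (cone x c); first exact: cone_in_chains.
pose r := c - bd o (cone x c).
have r0 : bd o r = 0 by rewrite raddfB /= c0 bary_bd_bd subrr.
have r_far a : x \notin bary_val a -> r a = 0.
  by move=> xa; rewrite !ffunE (bd_cone_coef cx xa) subrr.
have rx : r \in in_chains (bary_cl x) i.
  rewrite rpredB //; apply: bd_in_chains (cone_in_chains cx).
  exact: bary_cl_face.
suff rE : r = 0 by apply/esym/eqP; rewrite -subr_eq0 -/r rE.
apply/ffunP => a; rewrite [RHS]ffunE; apply/eqP.
have [xa|/r_far->//] := boolP (x \in bary_val a).
apply/negPn/negP => ra; have [_ ai] := (in_chainsP _ _ _ rx) a ra.
(* The chain consisting of [x] alone is the only vertex that contains [x]. *)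
have [a1|a1] := leqP #|bary_val a| 1.
  have aE e : x \in bary_val e -> (#|bary_val e| <= 1)%N -> bary_val e = [set x].
    by move=> xe e1; apply/esym/eqP; rewrite eqEcard sub1set xe cards1.
  have i0 : i = 0%N.
    by apply: succn_inj; rewrite -ai -bary_cardE (aE a) ?cards1.
  have : aug r = 0.
    rewrite raddfB /= aug0 // (bary_aug_bd (D := bary_cl x)) //.
    by rewrite -[1%N]/(0.+1)%N -i0; apply: cone_in_chains.
  rewrite /aug (bigD1 a) //= big1 ?addr0 => [r00|e ea].
    by rewrite r00 eqxx in ra.
  have [xe|/r_far//] := boolP (x \in bary_val e).
  apply: contraNeq ea => /(in_chainsP _ _ _ rx)[_ ei].
  by apply/eqP/bary_inj; rewrite (aE a) // (aE e) // bary_cardE ei i0.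
have [b bE ba] := bary_faceD1 a1 xa.
have xb : x \notin bary_val b by rewrite bE setD11.
have /ffunP/(_ b) := r0; rewrite bd_coef [RHS]ffunE (bigD1 a) //= big1.
  rewrite addr0 => /eqP; rewrite mulf_eq0 (negPf ra) orbF => /eqP inc0.
  have := incidence_sqr o bary_flags_connected ba.
  by rewrite inc0 mulr0.
move=> e /andP[be ea]; have [xe|/r_far->] := boolP (x \in bary_val e); last exact: mulr0.
case/eqP: ea; apply: bary_inj.
by rewrite (bary_coface be xe xb) (bary_coface ba xa xb).
Qed.

Lemma bary_max a : exists2 m, m \in bary_val a & {in bary_val a, forall y, (y <= m)%O}.
Proof.
have [+ /forall_inP ca] := baryP a; rewrite card_gt0 => /set0Pn[x0 x0a].
have [m ma mmax] := arg_maxnP rk x0a; exists m => // y ya.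
have /forall_inP/(_ m ma)/orP[//|my] := ca y ya.
have ym : (rk y <= rk m)%N := mmax y ya.
by move: my; rewrite le_eqVlt => /predU1P[->//|/rk_lt]; rewrite ltnNge ym.
Qed.

End BarycentricSubdivision.

(** * Comparison with the barycentric subdivision *)

Section Comparison.
Context {d : Order.disp_t} {S : cccType d} (o : orientations S).
Context (o' : orientations (bary S)).
Implicit Types (x y : S) (a b : bary S).

(** The closure of the largest cell of [a], defined without choosing that cell so
    that it is visibly monotone in [a]. *)
Definition lower_cells a : {set S} := [set y | [exists x in bary_val a, (y <= x)%O]].

Lemma lower_cellsE a : exists2 m, m \in bary_val a & lower_cells a = cl m.
Proof.
have [m ma mmax] := bary_max a; exists m => //; apply/setP => y; rewrite !inE.
apply/exists_inP/idP => [[x xa yx]|ym]; last by exists m.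
exact: le_trans yx (mmax x xa).
Qed.

Lemma lower_cells_sub a x : bary_val a \subset cl x -> lower_cells a \subset cl x.
Proof.
move=> /subsetP ax; have [m /ax + ->] := lower_cellsE a.
rewrite inE => mx; apply/subsetP => y; rewrite !inE => ym; exact: le_trans mx.
Qed.

Lemma bary_homology_iso : augmented_complex o ->
  (forall x, aug_acyclic o (cl x)) ->
  forall i, zmod_iso (homology o i) (homology o' i).
Proof.
move=> augS acycS i.
have clW x y : (y <= x)%O -> cl y \subset cl x.
  by move=> yx; apply/subsetP => z; rewrite !inE => /le_trans; apply.
have clF x y : y \in faces x -> cl y \subset cl x.
  by case/faceP=> /ltW/clW.
have baryF x y : y \in faces x -> bary_cl y \subset bary_cl x.
  by move=> yx; apply/subsetP => a; rewrite !bary_clE => /subset_trans; apply; apply: clF.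
have lowerF a b : b \in faces a -> lower_cells b \subset lower_cells a.
  rewrite bary_faceE => /andP[/subsetP ba _]; apply/subsetP => y; rewrite !inE.
  by case/exists_inP=> x /ba xa yx; apply/exists_inP; exists x.
have lower_acyclic a : aug_acyclic o (lower_cells a).
  by have [m _ ->] := lower_cellsE a.
have bary_lower a : bary_val a \subset lower_cells a.
  by apply/subsetP => x xa; rewrite inE; apply/exists_inP; exists x.
have [sd sdP] := carried_map_exists augS baryF (bary_cl_aug_acyclic o').
have [back backP] := carried_map_exists (bary_augmented o') lowerF lower_acyclic.
(* The carrier of both the identity and the composite on the subdivision. *)
pose Phi' a : {set bary S} := [set b | bary_val b \subset lower_cells a].
have Phi'E a : exists x, Phi' a = bary_cl x.
  by have [m _ aE] := lower_cellsE a; exists m; apply/setP => b; rewrite !inE aE.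
have Phi'F a b : b \in faces a -> Phi' b \subset Phi' a.
  move=> ba; apply/subsetP => e; rewrite !inE => /subset_trans; apply.
  exact: lowerF.
have Phi'_acyclic a : aug_acyclic o' (Phi' a).
  by have [x ->] := Phi'E a; apply: bary_cl_aug_acyclic.
apply: (@homology_iso _ _ _ _ o o' setT setT (lin sd) (lin back)).
- by move=> k; apply: carried_in_chains sdP.
- by move=> k; apply: carried_in_chains backP.
- exact: carried_bd sdP.
- exact: carried_bd backP.
- have idP : carried_map o o cl cell_chain.
    by apply: carried_id => x; rewrite inE.
  have compP : carried_map o o cl (fun x => lin back (sd x)).
    apply: carried_comp sdP backP => x a; rewrite bary_clE.
    exact: lower_cells_sub.
  move=> k c cD c0.
  have [b bD bE] := carried_maps_homotopic augS clF acycS compP idP cD c0.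
  by exists b; rewrite // bE lin_cell_chain (raddf_lin (lin back)).
have idP : carried_map o' o' Phi' cell_chain.
  by apply: carried_id => a; rewrite inE.
have compP : carried_map o' o' Phi' (fun a => lin sd (back a)).
  apply: carried_comp backP sdP => a x xa; apply/subsetP => b.
  rewrite bary_clE inE => /subset_trans; apply.
  have [m _ aE] := lower_cellsE a; rewrite aE in xa *.
  by apply: clW; rewrite inE in xa.
move=> k c cD c0.
have [b bD bE] := carried_maps_homotopic (bary_augmented o') Phi'F Phi'_acyclic
  compP idP cD c0.
by exists b; rewrite // bE lin_cell_chain (raddf_lin (lin sd)).
Qed.

End Comparison.

Theorem proposition8p5 (d : Order.disp_t) (S : cccType d) (n : nat)
    (S_manifold : manifold_like S n)
    (S_orientable : forall x : S, orientable (cl x))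
    (o : orientations S) (o' : orientations (bary S))
    (S_acyclic : forall x : S, acyclic o (cl x)) :
  forall i : nat, zmod_iso (homology o i) (homology o' i).
Proof.
have connS x := (S_orientable x).1.
have [[_ _ edge_vertices] _] := S_manifold.
have edge_faces (e : S) : rk e = 1%N -> #|faces e| = 2%N.
  move=> e1; rewrite -(edge_vertices e e1); apply: eq_card => v.
  rewrite !inE e1 eqSS eq_sym; have [v0|_] := eqVneq (rk v) 0%N; last by rewrite !andbF.
  by rewrite !andbT lt_neqAle; case: eqP => // ve; move: v0; rewrite ve e1.
apply: bary_homology_iso => [|x].
  by split; [apply: bd_bd_cell|apply: aug_bd_cell].
(* Any flag of [x] has a vertex. *)
have [g /flagsP[gx _ /(_ 0%N (leq0n _))/eqP/cards1P[v /setP/(_ v)]]] := flag_exists x.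
rewrite !inE eqxx => /andP[vg /eqP v0].
apply: (acyclic_aug_acyclic _ _ v0) (S_acyclic x); last by rewrite inE gx.
by move=> D c; apply: aug_bd.
Qed.
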